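(* Let $H=(V,E,w)$, $L$, $\mathcal{R}$ and $x_1$ be as in the context, and let $\gamma>0$. Suppose there exists a nonzero vector $y\in\mathbb{R}^V$ with $y\perp x_1$ and $\mathcal{R}(y)\le\gamma$. Then there exists an initial probability distribution $\varphi_0\in\mathbb{R}^V_{\ge0}$ (with $\sum_u\varphi_0(u)=1$) such that $\|\varphi_0-\varphi^*\|_1\ge\frac12$, and for any $\delta>0$ and any $t\le\frac{1}{4\gamma}\ln\frac{\sqrt{\varphi^*_{\min}}}{2\delta}$, the diffusion process $\frac{d\varphi_t}{dt}=-L\varphi_t$ started at $\varphi_0$ satisfies $\|\varphi_t-\varphi^*\|_1\ge\delta$. Here $\varphi^*=\frac{1}{w(V)}W\mathbf{1}$ and $\varphi^*_{\min}=\min_u\varphi^*(u)$.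
   Context: $H=(V,E,w)$: $V$ finite, $n=|V|\ge2$, hyperedges nonempty subsets of $V$, $w_e\ge0$, vertex weights $w_v=\sum_{e\ni v}w_e>0$, $w(X)=\sum_{v\in X}w_v$, $W=\mathrm{diag}(w_v)$, $\mathbf{1}$ all-ones, $x_1=W^{1/2}\mathbf{1}$. Laplacian. For $f\in\mathbb{R}^V$, $e\in E$: $S_e(f)$ ($I_e(f)$) is the set of $u\in e$ with $f_u$ maximal (minimal) in $e$, $c_e=w_e(\max_ef-\min_ef)$, $c(F)=\sum_{e\in F}c_e$. Define $r=r(f)$: partition $V$ into classes of equal $f$-value; for each class $U$ start with $E_U=\{e:(I_e(f)\cup S_e(f))\cap U\neq\emptyset\}$; for nonempty $X\subseteq U$ let $I_X=\{e\in E_U:I_e(f)\subseteq X\}$, $S_X=\{e\in E_U:S_e(f)\cap X\ne\emptyset\}$, $\delta(X)=(c(I_X)-c(S_X))/w(X)$; choose nonempty $P\subseteq U$ maximizing $\delta$, set $r_u=\delta(P)$ on $P$, and repeat with $U\setminus P$ and edge set $E_U\setminus(I_P\cup S_P)$ (result independent of choices). Set $\mathcal{L}_wf=-r(f)$, normalized Laplacian $\mathcal{L}x=W^{1/2}\mathcal{L}_w(W^{-1/2}x)$, Rayleigh quotient $\mathcal{R}(x)=\langle x,\mathcal{L}x\rangle/\langle x,x\rangle$, and measure-space operator $L\varphi=W\mathcal{L}_w(W^{-1}\varphi)$. Derivatives in the process are right-derivatives.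
   Formalization: In rounds after the first, I_e(f) ⊆ X is read as: the part of I_e(f) in the remaining set U is nonempty and contained in X, since otherwise r(f) depends on how ties between maximizers are broken; the diffusion process is taken to be continuous for t ≥ 0. *)

(* Defs.v *)
From HB Require Import structures.
From mathcomp Require Import all_boot all_order all_algebra.
From mathcomp Require Import all_classical all_reals all_analysis.

Set Implicit Arguments.
Unset Strict Implicit.
Unset Printing Implicit Defensive.

Import Order.TTheory GRing.Theory Num.Theory.
Import numFieldNormedType.Exports.

Local Open Scope ring_scope.

(* Only the values of [weight] on [edges] are ever used. *)
Record hypergraph (R : realType) (V : finType) := Hypergraph {
  edges : {set {set V}};
  weight : {set V} -> R;
  edges_neq0 : forall e, e \in edges -> e != finset.set0;
  weight_ge0 : forall e, e \in edges -> 0 <= weight e;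
  degree_gt0 : forall v, 0 < \sum_(e in edges | v \in e) weight e
}.

Section Hypergraph.
Context {R : realType} {V : finType}.
Implicit Types (H : hypergraph R V) (f x y phi : {ffun V -> R}).
Implicit Types (e U X : {set V}) (F : {set {set V}}).

Definition dot x y : R := \sum_u x u * y u.

Definition norm1 x : R := \sum_u `|x u|.

(* On a nonempty finite set these are an attained maximum and minimum. *)
Definition max_on e f : R := sup (f @` [set` e])%classic.
Definition min_on e f : R := inf (f @` [set` e])%classic.

Definition wdeg H (v : V) : R := \sum_(e in edges H | v \in e) weight H e.

Definition vol H X : R := \sum_(v in X) wdeg H v.

Definition x1 H : {ffun V -> R} := [ffun u => Num.sqrt (wdeg H u)].

Definition Smax f e : {set V} := [set u in e | f u == max_on e f].
Definition Imin f e : {set V} := [set u in e | f u == min_on e f].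

Definition cost H f e : R := weight H e * (max_on e f - min_on e f).

Definition costs H f F : R := \sum_(e in F) cost H f e.

(* [U] is the set of vertices of an equivalence class that have no rate yet,
   and [F] the set of edges still to be accounted for.  A remaining edge whose
   set [Imin f e] has lost some, but not all, of its vertices in earlier rounds
   is represented by the vertices left, [Imin f e :&: U].  In the first round
   [U] is a whole class, [Imin f e] is contained in it or disjoint from it, and
   the condition below just says [Imin f e \subset X].  Keeping [Imin f e] whole
   in later rounds would drop the inflow of such an edge altogether: mass would
   be lost, and the outcome would depend on how ties are broken. *)
Definition I_edges f U F X : {set {set V}} :=
  [set e in F | (Imin f e :&: U != finset.set0) && (Imin f e :&: U \subset X)].

Definition S_edges f F X : {set {set V}} :=
  [set e in F | Smax f e :&: X != finset.set0].

Definition density H f U F X : R :=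
  (costs H f (I_edges f U F X) - costs H f (S_edges f F X)) / vol H X.

(* Meaningful for nonempty [U]; ties are broken arbitrarily. *)
Definition densest H f U F : {set V} :=
  [arg max_(P > U | (P \subset U) && (P != finset.set0)) density H f U F P]%O.

(* Each round assigns a rate to at least one vertex, so [k = #|U|] rounds
   exhaust [U]. *)
Fixpoint rate_rec H f (k : nat) U F (u : V) : R :=
  if k is k'.+1 then
    let P := densest H f U F in
    if u \in P then density H f U F P
    else rate_rec H f k' (U :\: P)
           (F :\: (I_edges f U F P :|: S_edges f F P)) u
  else 0.

Definition level f (u : V) : {set V} := [set v | f v == f u].

Definition level_edges H f U : {set {set V}} :=
  [set e in edges H | (Imin f e :|: Smax f e) :&: U != finset.set0].

Definition rate H f : {ffun V -> R} :=
  [ffun u => let U := level f u in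
             rate_rec H f #|U| U (level_edges H f U) u].

Definition weighted_laplacian H f : {ffun V -> R} := [ffun u => - rate H f u].

Definition normalized_laplacian H x : {ffun V -> R} :=
  [ffun u => Num.sqrt (wdeg H u) *
             weighted_laplacian H [ffun v => x v / Num.sqrt (wdeg H v)] u].

Definition measure_laplacian H phi : {ffun V -> R} :=
  [ffun u => wdeg H u * weighted_laplacian H [ffun v => phi v / wdeg H v] u].

Definition rayleigh H x : R := dot x (normalized_laplacian H x) / dot x x.

Definition stationary H : {ffun V -> R} :=
  [ffun u => wdeg H u / vol H [set: V]].

Definition is_distribution phi : Prop :=
  (forall u, 0 <= phi u) /\ \sum_u phi u = 1.

(* Only times [t >= 0] matter.  The derivative is one-sided because the operator
   is discontinuous; continuity is required separately, since a right derivative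
   alone would allow the trajectory to jump. *)
Definition is_diffusion H (phi0 : {ffun V -> R}) (phi : R -> {ffun V -> R}) :
    Prop :=
  [/\ phi 0 = phi0,
      forall u, ({within `[0, +oo[, continuous (fun t : R => phi t u)})%classic &
      forall (t : R) u, 0 <= t ->
        ((fun h : R => (phi (t + h) u - phi t u) / h) @ 0^'+
           --> - measure_laplacian H (phi t) u)%classic].

End Hypergraph.

(* Main.v *)
Require Import Defs.
From HB Require Import structures.
From mathcomp Require Import all_boot all_order all_algebra.
From mathcomp Require Import all_classical all_reals all_analysis.
From mathcomp Require Import ring lra.

Set Implicit Arguments.
Unset Strict Implicit.
Unset Printing Implicit Defensive.

Import Order.TTheory GRing.Theory Num.Theory.
Import numFieldNormedType.Exports.

Local Open Scope ring_scope.

(** Write [f = phi / w], [r = rate f], [m = 1 / w(V)].  The energy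
    [E = sum_e w_e (max_e f - min_e f)^2] and the variance
    [N = sum_u w_u (f_u - m)^2] have right derivatives [N' = - 2 E] and
    [E' <= - 2 sum_u w_u r_u^2] along the diffusion, so [E <= rho N] is
    preserved and [N] decays at most like [exp (- 2 rho t)].  The bound on [E']
    holds because successive rounds of the densest-set procedure have
    nonincreasing densities: each edge is charged the largest rate on its
    maximal vertices and the smallest rate on its minimal vertices.

    For the initial distribution, cut [W^(-1/2) y] at a weighted median: its
    parts above and below the cut share the energy, so one of them has Rayleigh
    quotient at most [gamma].  Being supported on at most half of the weight, it
    is, once normalised, at distance at least [1] from [phi^*], and recentring
    at most doubles its Rayleigh quotient, so that [rho = 2 gamma]. *)

(** * Rates produced by the densest-set procedure, and the charging of edges to its rounds *)

Section Rates.
Context {R : realType} {V : finType}.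
Variable H : hypergraph R V.
Implicit Types (f : {ffun V -> R}) (e U X P Q : {set V}) (F : {set {set V}}).

Lemma max_onP e f : e != finset.set0 ->
  exists2 u, u \in e & max_on e f = f u /\ forall v, v \in e -> f v <= f u.
Proof.
case/set0Pn=> u0 u0e; case: (arg_maxP (fun u => f u) u0e) => u ue umax.
exists u => //; split=> //; apply/eqP; rewrite eq_le; apply/andP; split.
  apply: ge_sup; first by exists (f u0); exists u0.
  by move=> _ [v ve <-]; exact: umax.
apply: ub_le_sup; last by exists u.
by exists (f u) => _ [v ve <-]; exact: umax.
Qed.

Lemma min_onP e f : e != finset.set0 ->
  exists2 u, u \in e & min_on e f = f u /\ forall v, v \in e -> f u <= f v.
Proof.
case/set0Pn=> u0 u0e; case: (arg_minP (fun u => f u) u0e) => u ue umin.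
exists u => //; split=> //; apply/eqP; rewrite eq_le; apply/andP; split.
  apply: ge_inf; last by exists u.
  by exists (f u) => _ [v ve <-]; exact: umin.
apply: lb_le_inf; first by exists (f u0); exists u0.
by move=> _ [v ve <-]; exact: umin.
Qed.

Lemma wdeg_gt0 u : 0 < wdeg H u. Proof. exact: degree_gt0. Qed.

Lemma vol_gt0 X : X != finset.set0 -> 0 < vol H X.
Proof.
case/set0Pn=> u uX; rewrite /vol (bigD1 u) //= ltr_pwDl ?wdeg_gt0 //.
by apply: sumr_ge0 => v _; rewrite ltW ?wdeg_gt0.
Qed.

(** The numerator of [density]: unlike the quotient, it is additive over successive rounds. *)
Definition net_cost f U F X : R :=
  costs H f (I_edges f U F X) - costs H f (S_edges f F X).

(* For a level class [U] this always holds: an edge meeting [U] both in a minimal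
   and in a maximal vertex is constant, hence of cost [0]. *)
Definition one_sided f U F := forall e, e \in F -> cost H f e != 0 ->
  (Imin f e :&: U == finset.set0) || (Smax f e :&: U == finset.set0).

Definition rest_edges f U F P : {set {set V}} :=
  F :\: (I_edges f U F P :|: S_edges f F P).

Lemma in_rest_edges f U F P e : (e \in rest_edges f U F P) = (e \in F) &&
  ~~ ([&& Imin f e :&: U != finset.set0 & Imin f e :&: U \subset P]
      || (Smax f e :&: P != finset.set0)).
Proof. by rewrite !inE; case: (e \in F); rewrite ?andbF ?andbT. Qed.

Lemma one_sidedS f U F P :
  one_sided f U F -> one_sided f (U :\: P) (rest_edges f U F P).
Proof.
move=> hF e /setDP[eF _] ce0; have /orP[/eqP h|/eqP h] := hF e eF ce0.
  by rewrite finset.setDE finset.setIA h finset.set0I eqxx.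
by rewrite orbC finset.setDE finset.setIA h finset.set0I eqxx.
Qed.

Lemma net_costE f U F X : net_cost f U F X = \sum_(e in F) cost H f e *
  (((Imin f e :&: U != finset.set0) && (Imin f e :&: U \subset X))%:R
   - (Smax f e :&: X != finset.set0)%:R).
Proof.
rewrite /net_cost /costs /I_edges /S_edges.
under [X in X - _]eq_bigl do rewrite inE.
under [X in _ - X]eq_bigl do rewrite inE.
rewrite !big_mkcondr -sumrB; apply: eq_bigr => e _.
by do 2!case: ifP => _; rewrite /=; ring.
Qed.

(** On the minimal side an edge counts once [Imin f e :&: U] is covered, on the maximal side as soon
    as [Smax f e] is hit, hence in at most one of the two rounds. By [one_sided] an edge of nonzero
    cost lives on one side only, so removing it after that round loses nothing. *)
Lemma net_costU f U F P Q : one_sided f U F ->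
  P \subset U -> Q \subset U :\: P ->
  net_cost f U F (P :|: Q)
  = net_cost f U F P + net_cost f (U :\: P) (rest_edges f U F P) Q.
Proof.
move=> hF PU QU.
rewrite !net_costE [X in _ + X](eq_bigl _ _ (in_rest_edges f U F P)).
rewrite [X in _ + X]big_mkcondr.
rewrite -big_split /=; apply: eq_bigr => e eF.
have [->|ce0] := eqVneq (cost H f e) 0; first by rewrite !mul0r if_same addr0.
rewrite finset.setIUr finset.setU_eq0.
have [QU' QP] : Q \subset U /\ [disjoint Q & P] by apply/andP; rewrite -subsetD.
have DE (A : {set V}) : A :&: (U :\: P) = (A :&: U) :\: P by rewrite finset.setIDA.
rewrite DE finset.setD_eq0 subDset.
have [hI|nI] := boolP (Imin f e :&: U == finset.set0).
  rewrite (eqP hI) !finset.sub0set /=.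
  by case: (_ :&: P == _); case: (_ :&: Q == _); rewrite /=; ring.
have := hF e eF ce0; rewrite (negbTE nI) => /= /eqP hS.
have S0 (A : {set V}) : A \subset U -> Smax f e :&: A == finset.set0.
  by move=> AU; rewrite -finset.subset0 -hS finset.setIS.
rewrite !S0 //=.
have [sP|nsP] := boolP (_ \subset P).
  by rewrite (fintype.subset_trans sP) ?finset.subsetUl //=; ring.
by case: (_ \subset _); rewrite /=; ring.
Qed.

Lemma densestP f U F : U != finset.set0 ->
  [/\ densest H f U F \subset U, densest H f U F != finset.set0 &
      forall Q, Q \subset U -> Q != finset.set0 ->
        density H f U F Q <= density H f U F (densest H f U F)].
Proof.
move=> U0; rewrite /densest.
case: arg_maxP => [|P /andP[PU P0] hP]; first by rewrite subxx.
by split=> // Q QU Q0; apply: hP; rewrite QU.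
Qed.

Lemma volU P Q : [disjoint P & Q] -> vol H (P :|: Q) = vol H P + vol H Q.
Proof.
by move=> PQ; rewrite /vol -bigU //; apply: eq_bigl => u; rewrite !inE.
Qed.

Lemma density_vol f U F X : X != finset.set0 ->
  density H f U F X * vol H X = net_cost f U F X.
Proof. by move=> X0; rewrite /density divfK // gt_eqF ?vol_gt0. Qed.

(* A denser set in the next round could be merged into [P], contradicting the
   maximality of [P]. *)
Lemma density_rest_edges f U F Q (P := densest H f U F) : one_sided f U F ->
  Q \subset U :\: P -> Q != finset.set0 ->
  density H f (U :\: P) (rest_edges f U F P) Q <= density H f U F P.
Proof.
move=> hF QU Q0.
have [QU' QP] : Q \subset U /\ [disjoint Q & P] by apply/andP; rewrite -subsetD.
have U0 : U != finset.set0.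
  by apply: contraNneq Q0 => U0; rewrite -finset.subset0 -U0.
have [PU P0 maxP] := densestP f F U0; rewrite -/P in PU P0 maxP.
have PQ0 : P :|: Q != finset.set0 by rewrite finset.setU_eq0 (negbTE P0).
have := maxP (P :|: Q); rewrite finset.subUset PU QU' => /(_ isT PQ0).
rewrite -(ler_pM2r (vol_gt0 PQ0)) density_vol // net_costU //.
rewrite volU 1?disjoint_sym // mulrDr density_vol // lerD2l.
by rewrite -density_vol // ler_pM2r // vol_gt0.
Qed.

Lemma cardsD_densest f U F k : (#|U| <= k.+1)%N -> U != finset.set0 ->
  (#|U :\: densest H f U F| <= k)%N.
Proof.
move=> Uk U0; have [PU P0 _] := densestP f F U0.
rewrite cardsD (finset.setIidPr PU) leq_subLR (leq_trans Uk) //.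
by rewrite -add1n leq_add2r card_gt0.
Qed.

(** By [density_rest_edges] the densities of successive rounds never increase, so the first one
    dominates every rate. *)
Lemma rate_rec_le f U F k u : one_sided f U F -> (#|U| <= k)%N -> u \in U ->
  rate_rec H f k U F u <= density H f U F (densest H f U F).
Proof.
elim: k U F => [|k IH] U F hF Uk uU.
  by move: Uk; rewrite leqn0 cards_eq0 => /eqP U0; rewrite U0 inE in uU.
rewrite /=; case: ifPn => // uP.
have uU' : u \in U :\: densest H f U F by rewrite inE uP.
have U0 : U != finset.set0 by apply/set0Pn; exists u.
have U'0 : U :\: densest H f U F != finset.set0 by apply/set0Pn; exists u.
apply: le_trans (IH _ _ _ _ uU') _; first exact: one_sidedS.
  exact: cardsD_densest.
have [QU' Q0 _] := densestP f (rest_edges f U F (densest H f U F)) U'0.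
exact: density_rest_edges.
Qed.

(** Splits off the first round, where the rate is constant. The function [g] will be the identity
    for the total mass and the square for the dissipation. *)
Lemma sum_rate_rec f U F k (g : R -> R) : U != finset.set0 ->
  let P := densest H f U F in
  \sum_(u in U) wdeg H u * g (rate_rec H f k.+1 U F u) =
  vol H P * g (density H f U F P) +
  \sum_(u in U :\: P)
     wdeg H u * g (rate_rec H f k (U :\: P) (rest_edges f U F P) u).
Proof.
move=> U0 P; have [PU _ _] := densestP f F U0; rewrite -/P in PU.
rewrite (big_setID P) /= (finset.setIidPr PU); congr (_ + _).
  by rewrite /vol mulr_suml; apply: eq_bigr => u uP; rewrite -/P uP.
by apply: eq_bigr => u; rewrite inE -/P => /andP[/negbTE-> _].
Qed.

Lemma net_cost0 f U F : net_cost f U F finset.set0 = 0.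
Proof.
rewrite net_costE big1 // => e _; rewrite finset.subset0 finset.setI0 eqxx.
by rewrite andNb subrr mulr0.
Qed.

(** Each round contributes its density times its volume, which is its net cost, and [net_costU] adds
    these up. *)
Lemma rate_rec_sum f U F k : one_sided f U F -> (#|U| <= k)%N ->
  \sum_(u in U) wdeg H u * rate_rec H f k U F u = net_cost f U F U.
Proof.
elim: k U F => [|k IH] U F hF Uk.
  move: Uk; rewrite leqn0 cards_eq0 => /eqP->.
  by rewrite finset.big_set0 net_cost0.
have [->|U0] := eqVneq U finset.set0; first by rewrite finset.big_set0 net_cost0.
rewrite (sum_rate_rec f F k id) //=; have [PU P0 _] := densestP f F U0.
rewrite IH ?cardsD_densest //; last exact: one_sidedS.
rewrite mulrC density_vol // -net_costU //.
by rewrite -{1}(finset.setIidPr PU) finset.setID.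
Qed.

Lemma cost_ge0 f e : e \in edges H -> 0 <= cost H f e.
Proof.
move=> eE; have e0 := edges_neq0 eE; rewrite /cost.
have [u ue [-> _]] := max_onP f e0; have [v ve [-> h]] := min_onP f e0.
by rewrite mulr_ge0 ?weight_ge0 // subr_ge0 h.
Qed.

(* The edge [e] is charged to the last round meeting [Imin f e], where the rate
   is least, and to the first round meeting [Smax f e], where it is greatest. *)
Lemma rate_rec_sqr f U F k (a b : {set V} -> R) :
  one_sided f U F -> (#|U| <= k)%N -> F \subset edges H ->
  (forall e, e \in F -> Imin f e :&: U != finset.set0 ->
     exists2 u, u \in Imin f e :&: U & rate_rec H f k U F u <= b e) ->
  (forall e, e \in F -> Smax f e :&: U != finset.set0 ->
     exists2 u, u \in Smax f e :&: U & a e <= rate_rec H f k U F u) ->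
  \sum_(u in U) wdeg H u * rate_rec H f k U F u ^+ 2 <=
  \sum_(e in F | Imin f e :&: U != finset.set0) cost H f e * b e -
  \sum_(e in F | Smax f e :&: U != finset.set0) cost H f e * a e.
Proof.
elim: k U F => [|k IH] U F hF Uk FE hb ha.
  move: Uk; rewrite leqn0 cards_eq0 => /eqP U0; rewrite U0.
  rewrite finset.big_set0 !big1 ?subr0 // => e; by rewrite finset.setI0 eqxx andbF.
have [U0|U0] := eqVneq U finset.set0.
  rewrite U0 finset.big_set0 !big1 ?subr0 // => e.
    by rewrite finset.setI0 eqxx andbF.
  by rewrite finset.setI0 eqxx andbF.
have hle u : u \in U -> _ := @rate_rec_le f U F k.+1 u hF Uk.
rewrite (sum_rate_rec f F k (fun x => x ^+ 2)) //=.
have [PU P0 _] := densestP f F U0.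
set P := densest H f U F in PU P0 hle *; set d := density H f U F P in hle *.
have rP u : u \in P -> rate_rec H f k.+1 U F u = d by move=> uP /=; rewrite -/P uP.
have rN u : u \notin P ->
    rate_rec H f k.+1 U F u = rate_rec H f k (U :\: P) (rest_edges f U F P) u.
  by move=> /negbTE uP /=; rewrite -/P uP.
have nF e : e \in rest_edges f U F P -> e \in F by rewrite !inE => /andP[].
have {}IH := IH _ _ (@one_sidedS _ _ _ _ hF) (cardsD_densest f F Uk U0).
have /IH{}IH : rest_edges f U F P \subset edges H.
  by apply/fintype.subsetP=> e /nF; apply: (fintype.subsetP FE).
have /IH{}IH : forall e, e \in rest_edges f U F P ->
    Imin f e :&: (U :\: P) != finset.set0 ->
    exists2 u, u \in Imin f e :&: (U :\: P) &
      rate_rec H f k (U :\: P) (rest_edges f U F P) u <= b e.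
  move=> e eF' /set0Pn[v]; rewrite !inE => /and3P[vI vP vU].
  have [|u uI ub] := hb e (nF _ eF').
    by apply/set0Pn; exists v; rewrite !inE vI.
  (* If the witness [u] is used up in this round, its rate is [d], which dominates the rate of every
     vertex [v] left. *)
  have [uP|uP] := boolP (u \in P).
    exists v; first by rewrite !inE vI vP.
    by rewrite -rN // (le_trans (hle v vU)) // -(rP u).
  exists u; last by rewrite -rN.
  by move: uI; rewrite !inE uP.
have /IH{}IH : forall e, e \in rest_edges f U F P ->
    Smax f e :&: (U :\: P) != finset.set0 ->
    exists2 u, u \in Smax f e :&: (U :\: P) &
      a e <= rate_rec H f k (U :\: P) (rest_edges f U F P) u.
  move=> e eF' /set0Pn[v]; rewrite !inE => /and3P[vI vP vU].
  have [|u uI ub] := ha e (nF _ eF').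
    by apply/set0Pn; exists v; rewrite !inE vI.
  (* A witness in [P] would make [Smax f e] meet [P], and the edge would have been removed. *)
  have uP : u \notin P.
    apply: contraL (eF') => uP; rewrite !inE (nF _ eF').
    suff -> : Smax f e :&: P != finset.set0 by rewrite orbT.
    by apply/set0Pn; exists u; move: uI; rewrite !inE uP => /andP[->].
  exists u; last by rewrite -rN.
  by move: uI; rewrite !inE uP.
move: IH; rewrite -(lerD2l (vol H P * d ^+ 2)) => /le_trans; apply.
have -> : vol H P * d ^+ 2 = net_cost f U F P * d.
  by rewrite -density_vol // -/d; ring.
rewrite net_costE mulr_suml.
rewrite !big_mkcondr -!sumrB.
rewrite [X in _ + X](eq_bigl _ _ (in_rest_edges f U F P)).
rewrite [X in _ + X]big_mkcondr -big_split /=.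
(* Edge by edge: an edge processed in this round is charged [d], where [a e <= d] on the maximal
   side and [d <= b e] on the minimal side; any other edge is left to the induction hypothesis. *)
apply: ler_sum => e eF.
have c0 : 0 <= cost H f e by apply: cost_ge0; apply: (fintype.subsetP FE).
have [->|ce0] := eqVneq (cost H f e) 0.
  by rewrite !mul0r !if_same subrr if_same addr0.
have DE (A : {set V}) : A :&: (U :\: P) = (A :&: U) :\: P by rewrite finset.setIDA.
rewrite !DE.
have [hI|nI] := boolP (Imin f e :&: U == finset.set0).
  rewrite (eqP hI) finset.set0D eqxx /=.
  have [hS|nS] := boolP (Smax f e :&: U == finset.set0).
    rewrite (eqP hS) finset.set0D eqxx /=.
    have -> : Smax f e :&: P == finset.set0.
      by rewrite -finset.subset0 -(eqP hS) finset.setIS.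
    by rewrite /=; lra.
  have [u uS ua] := ha e eF nS.
  have [hP|nP] := boolP (Smax f e :&: P == finset.set0).
    have -> : (Smax f e :&: U) :\: P = Smax f e :&: U.
      apply/finset.setDidPl; rewrite -finset.setI_eq0 -finset.setIA.
      by rewrite (finset.setIidPr PU).
    by rewrite (negbTE nS) /=; lra.
  have: a e <= d.
    by apply: le_trans ua (hle _ _); move: uS; rewrite inE => /andP[].
  by rewrite /= => /(ler_wpM2l c0); lra.
have := hF e eF ce0; rewrite (negbTE nI) => /= /eqP hS.
have -> : Smax f e :&: P == finset.set0.
  by rewrite -finset.subset0 -hS finset.setIS.
rewrite hS finset.set0D eqxx /= finset.setD_eq0.
have [sP|nsP] := boolP (_ \subset P); last by rewrite /=; lra.
have [u uI ub] := hb e eF nI.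
by move: ub; rewrite rP ?(fintype.subsetP sP) // => /(ler_wpM2l c0) /=; lra.
Qed.

End Rates.

(** * Energy identities obtained by summing over the level classes *)

Section Energy.
Context {R : realType} {V : finType}.
Variable H : hypergraph R V.
Implicit Types (f : {ffun V -> R}) (e U : {set V}) (F : {set {set V}}).

(* This is [<x, L x>] for [x = W^(1/2) f]. *)
Definition energy f : R :=
  \sum_(e in edges H) cost H f e * (max_on e f - min_on e f).

(** The class of value [x], possibly empty: the key under which edges are grouped by their minimum
    or maximum. *)
Let fiber f (x : R) : {set V} := [set v | f v == x].

Lemma Imin_fiber f e u : e \in edges H ->
  (Imin f e :&: level f u != finset.set0) = (fiber f (min_on e f) == level f u).
Proof.
move=> eE; have [v ve [minE _]] := min_onP f (edges_neq0 eE).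
apply/set0Pn/eqP => [[x]|E].
  rewrite !inE => /andP[/andP[xe /eqP <-] /eqP xu].
  by apply/setP => z; rewrite !inE xu.
exists v; rewrite !inE ve minE eqxx /=.
by have /setP/(_ v) := E; rewrite !inE minE eqxx => <-.
Qed.

Lemma Smax_fiber f e u : e \in edges H ->
  (Smax f e :&: level f u != finset.set0) = (fiber f (max_on e f) == level f u).
Proof.
move=> eE; have [v ve [maxE _]] := max_onP f (edges_neq0 eE).
apply/set0Pn/eqP => [[x]|E].
  rewrite !inE => /andP[/andP[xe /eqP <-] /eqP xu].
  by apply/setP => z; rewrite !inE xu.
exists v; rewrite !inE ve maxE eqxx /=.
by have /setP/(_ v) := E; rewrite !inE maxE eqxx => <-.
Qed.

Lemma level_one_sided f u F : one_sided H f (level f u) F.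
Proof.
move=> e eF; apply: contraNT; rewrite negb_or.
case/andP=> /set0Pn[x] + /set0Pn[y].
rewrite !inE => /andP[/andP[_ /eqP xm] /eqP xu] /andP[/andP[_ /eqP ym] /eqP yu].
by rewrite /cost -xm -ym xu yu subrr mulr0.
Qed.

(** Each edge has its minimal vertices in exactly one level and its maximal vertices in exactly one,
    so summing over levels counts every [B e] and every [C e] once. *)
Lemma sum_levels_le f (A : V -> R) (B C : {set V} -> R) :
  (forall u, \sum_(v in level f u) A v <=
     \sum_(e in edges H | Imin f e :&: level f u != finset.set0) B e -
     \sum_(e in edges H | Smax f e :&: level f u != finset.set0) C e) ->
  \sum_u A u <= \sum_(e in edges H) (B e - C e).
Proof.
move=> h; rewrite sumrB (partition_big (level f) xpredT) //=.
rewrite [X in _ <= X - _](partition_big (fun e => fiber f (min_on e f)) xpredT) //=.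
rewrite [X in _ <= _ - X](partition_big (fun e => fiber f (max_on e f)) xpredT) //=.
rewrite -sumrB; apply: ler_sum => U _.
have [/existsP[u /eqP <-]|/existsPn nU] := boolP [exists u, level f u == U].
  have lvlE v : (v \in level f u) = (level f v == level f u).
    rewrite inE; apply/eqP/eqP => [fv|/setP/(_ v)].
      by apply/setP => z; rewrite !inE fv.
    by rewrite !inE eqxx => /esym/eqP.
  rewrite -(eq_bigl _ _ lvlE); apply: le_trans (h u) _; rewrite lerB //.
    rewrite le_eqVlt; apply/orP; left; apply/eqP; apply: eq_bigl => e.
    by have [eE|//] := boolP (e \in edges H); rewrite /= Imin_fiber.
  rewrite le_eqVlt; apply/orP; left; apply/eqP; apply: eq_bigl => e.
  by have [eE|//] := boolP (e \in edges H); rewrite /= Smax_fiber.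
rewrite big_pred0; last by move=> u; apply/negbTE/nU.
rewrite !big_pred0 ?subr0 // => e; have [eE|//] := boolP (e \in edges H).
  have [v _ [-> _]] := max_onP f (edges_neq0 eE).
  by apply/negbTE; exact: (nU v).
have [v _ [-> _]] := min_onP f (edges_neq0 eE).
by apply/negbTE; exact: (nU v).
Qed.

Lemma rate_level f u v : v \in level f u -> rate H f v =
  rate_rec H f #|level f u| (level f u) (level_edges H f (level f u)) v.
Proof.
rewrite inE => /eqP fv; rewrite ffunE.
by have -> : level f v = level f u by apply/setP => z; rewrite !inE fv.
Qed.

Lemma big_level_edgesI f u (B : {set V} -> R) :
  \sum_(e in level_edges H f (level f u) | Imin f e :&: level f u != finset.set0) B e
  = \sum_(e in edges H | Imin f e :&: level f u != finset.set0) B e.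
Proof.
apply: eq_bigl => e; rewrite inE finset.setIUl finset.setU_eq0 negb_and.
by rewrite -andbA; congr andb; rewrite andb_idl // => ->.
Qed.

Lemma big_level_edgesS f u (B : {set V} -> R) :
  \sum_(e in level_edges H f (level f u) | Smax f e :&: level f u != finset.set0) B e
  = \sum_(e in edges H | Smax f e :&: level f u != finset.set0) B e.
Proof.
apply: eq_bigl => e; rewrite inE finset.setIUl finset.setU_eq0 negb_and orbC.
by rewrite -andbA; congr andb; rewrite andb_idl // => ->.
Qed.

(** Mass balance of a class: inflow through minimal vertices minus outflow through maximal ones,
    read off [rate_rec_sum] on the whole class. *)
Lemma level_rate_sum f u : \sum_(v in level f u) wdeg H v * rate H f v =
  \sum_(e in edges H | Imin f e :&: level f u != finset.set0) cost H f e -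
  \sum_(e in edges H | Smax f e :&: level f u != finset.set0) cost H f e.
Proof.
under eq_bigr => v vu do rewrite (rate_level vu).
rewrite rate_rec_sum //; last exact: level_one_sided.
rewrite /net_cost /costs -big_level_edgesI -big_level_edgesS.
by congr (_ - _); apply: eq_bigl => e; rewrite !inE // finset.subsetIr andbT.
Qed.

(** The factor [h (f u)] is constant on each level and comes out of [level_rate_sum]. Equality
    follows by applying [sum_levels_le] to the sum and to its negative. *)
Lemma sum_fun_rate f (h : R -> R) :
  \sum_u wdeg H u * h (f u) * rate H f u =
  \sum_(e in edges H) cost H f e * (h (min_on e f) - h (max_on e f)).
Proof.
have lvl u :
    \sum_(v in level f u) wdeg H v * h (f v) * rate H f v =
    \sum_(e in edges H | Imin f e :&: level f u != finset.set0)
      cost H f e * h (min_on e f) -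
    \sum_(e in edges H | Smax f e :&: level f u != finset.set0)
      cost H f e * h (max_on e f).
  transitivity (h (f u) * \sum_(v in level f u) wdeg H v * rate H f v).
    rewrite mulr_sumr; apply: eq_bigr => v; rewrite inE => /eqP->.
    by rewrite mulrAC mulrC.
  rewrite level_rate_sum mulrBr !mulr_sumr; congr (_ - _).
    apply: eq_bigr => e /andP[_ /set0Pn[v]]; rewrite !inE mulrC.
    by case/andP=> /andP[_ /eqP<-] /eqP->.
  apply: eq_bigr => e /andP[_ /set0Pn[v]]; rewrite !inE mulrC.
  by case/andP=> /andP[_ /eqP<-] /eqP->.
under [RHS]eq_bigr do rewrite mulrBr.
apply/eqP; rewrite eq_le; apply/andP; split.
  apply: (@sum_levels_le f (fun v => wdeg H v * h (f v) * rate H f v)) => u.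
  by rewrite lvl.
rewrite -lerN2 -!sumrN; under [X in _ <= X]eq_bigr do rewrite opprD.
apply: (@sum_levels_le f (fun v => - (wdeg H v * h (f v) * rate H f v))
  (fun e => - (cost H f e * h (min_on e f)))
  (fun e => - (cost H f e * h (max_on e f)))) => u.
by rewrite !sumrN lvl opprD.
Qed.

Lemma energyE f (m : R) :
  \sum_u wdeg H u * (f u - m) * rate H f u = - energy f.
Proof.
rewrite (sum_fun_rate f (fun x => x - m)) /energy -sumrN.
by apply: eq_bigr => e _; ring.
Qed.

Lemma sum_rate_sqr f (a b : {set V} -> R) :
  (forall e, e \in edges H -> exists2 u, u \in Imin f e & rate H f u <= b e) ->
  (forall e, e \in edges H -> exists2 u, u \in Smax f e & a e <= rate H f u) ->
  \sum_u wdeg H u * rate H f u ^+ 2 <=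
  \sum_(e in edges H) cost H f e * (b e - a e).
Proof.
move=> hb ha; under [X in _ <= X]eq_bigr do rewrite mulrBr.
apply: (@sum_levels_le f) => u.
under eq_bigr => v vu do rewrite (rate_level vu).
rewrite -big_level_edgesI -big_level_edgesS.
have sE : level_edges H f (level f u) \subset edges H.
  by apply/fintype.subsetP => e; rewrite inE => /andP[].
apply: rate_rec_sqr => //; first exact: level_one_sided.
- move=> e /(fintype.subsetP sE) eE /set0Pn[v]; rewrite !inE.
  case/andP=> /andP[_ /eqP vm] /eqP vu.
  have [x xI xb] := hb e eE.
  have xu : x \in level f u by move: xI; rewrite !inE -vm vu => /andP[].
  by exists x; rewrite -?rate_level // inE xI xu.
- move=> e /(fintype.subsetP sE) eE /set0Pn[v]; rewrite !inE.
  case/andP=> /andP[_ /eqP vm] /eqP vu.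
  have [x xI xb] := ha e eE.
  have xu : x \in level f u by move: xI; rewrite !inE -vm vu => /andP[].
  by exists x; rewrite -?rate_level // inE xI xu.
Qed.

End Energy.

(** * One-sided differential inequalities *)

Section RightDini.
Local Open Scope classical_set_scope.
Context {R : realType}.
Implicit Types (u : R -> R) (t l eps : R).

(** An upper bound on the upper right Dini derivative, in epsilon form so that it applies to the
    energy without assuming a right derivative. *)
Definition dini_le u t l := forall eps, 0 < eps ->
  \forall h \near 0^'+, u (t + h) <= u t + h * (l + eps).

Definition nonneg_continuous u := forall t, 0 <= t ->
  u x @[x --> within `[0, +oo[ (nbhs t)] --> u t.

Lemma near_right_mul_le (K eps : R) : 0 < eps ->
  \forall h \near 0^'+, h * K <= eps.
Proof.
move=> e0; have K0 : 0 < `|K| + 1 by rewrite ltr_wpDl.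
near=> h; have h0 : 0 < h by near: h; exact: nbhs_right_gt.
apply: (@le_trans _ _ (h * (`|K| + 1))).
  by rewrite ler_pM2l // (le_trans (ler_norm K)) // lerDl.
rewrite -ler_pdivlMr //; near: h; apply: nbhs_right_le.
by rewrite divr_gt0.
Unshelve. all: by end_near. Qed.

(** If [u] exceeded the line [eps * (1 + t)] somewhere, let [s] be the infimum of such times.
    Continuity from the left keeps [u s] below the line, and just after [s] the function stays below
    it as well, contradicting the choice of [s]. *)
Lemma dini_le0_nonpos u : nonneg_continuous u -> u 0 <= 0 ->
  (forall t, 0 <= t -> 0 < u t -> dini_le u t 0) ->
  forall t, 0 <= t -> u t <= 0.
Proof.
move=> cu u0 du t0 t00; apply/ler_addgt0Pr => e e0; rewrite add0r.
(* The line then takes the value [e] at [t0]; its offset keeps it strictly positive at every time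
   from [0] on. *)
pose eps := e / (1 + t0).
have eps0 : 0 < eps by rewrite divr_gt0 // ltr_pwDl.
have -> : e = eps * (1 + t0) by rewrite divfK // gt_eqF // ltr_pwDl.
rewrite leNgt; apply/negP => hlt.
pose A := [set t | 0 <= t /\ eps * (1 + t) < u t].
have Ah : has_inf A.
  by split; [exists t0 | exists 0 => x []].
have s0 : 0 <= inf A.
  by apply: lb_le_inf; [exists t0 | move=> x []].
have Alb x : A x -> inf A <= x by move=> Ax; apply: ge_inf => //; case: Ah.
set s := inf A in s0 Alb.
have [hs|hs] := ltP (eps * (1 + s)) (u s).
  have sgt0 : 0 < s.
    rewrite lt_neqAle s0 andbT; apply/eqP => s_0; move: hs; rewrite -s_0.
    by rewrite ltNge (le_trans u0) // mulr_ge0 // ltW.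
  have : within `[0, +oo[ (nbhs s) [set x | eps * (1 + s) < u x].
    exact: (@cvgr_gt _ _ _ _ _ _ (cu s s0) _ hs).
  rewrite /within => /nbhs_ballP[d /= d0 hd].
  pose x := Num.max 0 (s - d / 2).
  have xs : x < s by rewrite gt_max sgt0 /=; lra.
  have x0 : 0 <= x by rewrite le_max lexx.
  have xd : s - d / 2 <= x by rewrite le_max lexx orbT.
  have ux : eps * (1 + s) < u x.
    apply: hd; last by rewrite /= in_itv /= x0.
    by rewrite /ball /= gtr0_norm; lra.
  suff /Alb : A x by rewrite leNgt xs.
  by split => //; apply: le_lt_trans ux; rewrite ler_pM2l // lerD2l ltW.
suff : nbhs 0 [set h | 0 < h -> u (s + h) <= eps * (1 + (s + h))].
  move=> /nbhs_ballP[d /= d0 hd].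
  have [a [a0 ua] ad] := inf_adherent d0 Ah.
  have : s <= a by exact: Alb.
  rewrite le_eqVlt => /orP[/eqP sa|sa]; first by move: hs; rewrite sa leNgt ua.
  have := hd (a - s); rewrite /ball /= sub0r normrN gtr0_norm ?subr_gt0 //.
  rewrite [s + _]addrC subrK leNgt ua => /(_ _ sa) h.
  by apply/notF/h; rewrite -/s in ad; lra.
change (\forall h \near 0^'+, u (s + h) <= eps * (1 + (s + h))).
(* Where [u s] is positive its slope is at most [eps], that of the line; otherwise [u s] is strictly
   below the line and continuity suffices. *)
have [us|us] := ltP 0 (u s).
  near=> h; have h0 : 0 < h by near: h; exact: nbhs_right_gt.
  have : u (s + h) <= u s + h * (0 + eps) by near: h; exact: du.
  by lra.
have hs' : u s < eps * (1 + s) by apply: le_lt_trans us _; rewrite mulr_gt0 // ltr_pwDl.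
have : within `[0, +oo[ (nbhs s) [set x | u x < eps * (1 + s)].
  exact: (@cvgr_lt _ _ _ _ _ _ (cu s s0) _ hs').
rewrite /within => /nbhs_ballP[d /= d0 hd].
near=> h; have h0 : 0 < h by near: h; exact: nbhs_right_gt.
have hd' : h < d by near: h; exact: nbhs_right_lt.
apply: ltW; apply: (@lt_trans _ _ (eps * (1 + s))).
  apply: hd; last by rewrite /= in_itv /= andbT addr_ge0 // ltW.
  by rewrite /ball /= opprD addrA subrr sub0r normrN gtr0_norm.
by rewrite ltr_pM2l // ltrD2l ltrDl.
Unshelve. all: by end_near. Qed.

End RightDini.

(** * The flow in the coordinates [phi / w], and the right derivative of the variance *)

Section Flow.
Local Open Scope classical_set_scope.
Context {R : realType} {V : finType}.
Variable H : hypergraph R V.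
Implicit Types (f g : {ffun V -> R}) (e U : {set V}).

Lemma max_on_dist e f g eps : e != finset.set0 ->
  (forall u, u \in e -> `|f u - g u| <= eps) ->
  `|max_on e f - max_on e g| <= eps.
Proof.
move=> e0 h; have [u ue [-> fu]] := max_onP f e0.
have [v ve [-> gv]] := max_onP g e0.
have := h u ue; have := h v ve; have := fu v ve; have := gv u ue.
by rewrite !ler_norml => ? ? /andP[? ?] /andP[? ?]; apply/andP; split; lra.
Qed.

Lemma min_on_dist e f g eps : e != finset.set0 ->
  (forall u, u \in e -> `|f u - g u| <= eps) ->
  `|min_on e f - min_on e g| <= eps.
Proof.
move=> e0 h; have [u ue [-> fu]] := min_onP f e0.
have [v ve [-> gv]] := min_onP g e0.
have := h u ue; have := h v ve; have := fu v ve; have := gv u ue.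
by rewrite !ler_norml => ? ? /andP[? ?] /andP[? ?]; apply/andP; split; lra.
Qed.

(* For [f = phi / w] and [m = 1 / w(V)] this is the squared norm of
   [W^(-1/2) (phi - stationary)]. *)
Definition wnorm2 f (m : R) : R := \sum_u wdeg H u * (f u - m) ^+ 2.

(** The diffusion in the coordinates [phi / w], where the weights cancel and the velocity is exactly
    [rate]. *)
Definition rate_flow (f : R -> {ffun V -> R}) : Prop :=
  (forall u, nonneg_continuous (fun t => f t u)) /\
  forall t u, 0 <= t ->
    (f (t + h) u - f t u) / h @[h --> 0^'+] --> rate H (f t) u.

Lemma is_diffusion_flow phi0 phi : is_diffusion H phi0 phi ->
  rate_flow (fun t => [ffun v => phi t v / wdeg H v]).
Proof.
case=> _ cphi dphi; split=> [u t t0|t u t0].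
  under eq_cvg do rewrite ffunE; rewrite ffunE.
  apply: cvgMr_tmp.
  have /subspace_continuousP := cphi u; apply.
  by rewrite /= in_itv /= t0.
have w0 : wdeg H u != 0 by rewrite gt_eqF ?wdeg_gt0.
have -> : rate H [ffun v => phi t v / wdeg H v] u =
    - measure_laplacian H (phi t) u / wdeg H u.
  rewrite !ffunE; field.
  exact: w0.
under eq_cvg do rewrite !ffunE -mulrBl mulrAC.
exact: cvgMr_tmp (dphi t u t0).
Qed.

Variables (f : R -> {ffun V -> R}) (m : R).
Hypothesis f_flow : rate_flow f.

Lemma wnorm2_continuous : nonneg_continuous (fun t => wnorm2 (f t) m).
Proof.
move=> t t0; rewrite /wnorm2; apply: cvg_big => [|u _].
  exact: add_continuous.
apply: cvgMl_tmp; under eq_cvg do rewrite expr2; rewrite expr2.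
by apply: cvgM; apply: cvgB (cvg_cst _); apply: (f_flow.1 u).
Qed.

Lemma energy_continuous : nonneg_continuous (fun t => energy H (f t)).
Proof.
move=> t t0; rewrite /energy; apply: cvg_big => [|e eE].
  exact: add_continuous.
have e0 := edges_neq0 eE.
have near_f eps : 0 < eps ->
    \forall x \near within `[0, +oo[ (nbhs t),
      forall u, `|f t u - f x u| <= eps.
  move=> eps0; apply: filter_forall => u.
  by have /cvgrPdist_le := f_flow.1 u t t0; apply.
have cmax : max_on e (f x) @[x --> within `[0, +oo[ (nbhs t)] --> max_on e (f t).
  apply/cvgrPdist_le => eps /near_f; apply: filterS => x h.
  by apply: max_on_dist.
have cmin : min_on e (f x) @[x --> within `[0, +oo[ (nbhs t)] --> min_on e (f t).
  apply/cvgrPdist_le => eps /near_f; apply: filterS => x h.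
  by apply: min_on_dist.
by apply: cvgM; [apply: cvgMl_tmp|]; apply: cvgB.
Qed.

(** First-order expansion, uniform in the vertex because [V] is finite. *)
Lemma flow_near t eps : 0 <= t -> 0 < eps ->
  \forall h \near 0^'+, forall u,
    `|f (t + h) u - (f t u + h * rate H (f t) u)| <= h * eps.
Proof.
move=> t0 eps0; apply: filter_forall => u.
have /cvgrPdist_le/(_ _ eps0) hu := f_flow.2 t u t0.
near=> h; have h0 : 0 < h by near: h; exact: nbhs_right_gt.
have : `|rate H (f t) u - (f (t + h) u - f t u) / h| <= eps by near: h.
rewrite -(ler_pM2l h0) -{1}(gtr0_norm h0) -normrM distrC.
by congr (`| _ | <= _); field; rewrite gt_eqF.
Unshelve. all: by end_near. Qed.

(** A difference of squares factors through the difference quotient of [f]; the limit is twice the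
    sum of [wdeg * (f - m) * rate], which [energyE] evaluates. *)
Lemma wnorm2_right_derivative t : 0 <= t ->
  (wnorm2 (f (t + h)) m - wnorm2 (f t) m) / h @[h --> 0^'+]
  --> - 2 * energy H (f t).
Proof.
move=> t0; have c0 : forall u, f (t + h) u @[h --> 0^'+] --> f t u.
  move=> u; apply/cvgrPdist_le => eps eps0.
  have := near_right_mul_le (`|rate H (f t) u| + 1) eps0.
  have := flow_near t0 (ltr01 : 0 < 1 :> R).
  move=> hf hK; near=> h; have h0 : 0 < h by near: h; exact: nbhs_right_gt.
  have : h * (`|rate H (f t) u| + 1) <= eps by near: h.
  have /(_ u) : forall u, `|f (t + h) u - (f t u + h * rate H (f t) u)| <= h * 1.
    by near: h.
  have : `|h * rate H (f t) u| <= h * `|rate H (f t) u|.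
    by rewrite normrM gtr0_norm.
  by rewrite !ler_norml => /andP[? ?] /andP[? ?] ?; apply/andP; split; lra.
have -> : - 2 * energy H (f t) = \sum_u wdeg H u *
    ((f t u + f t u - 2 * m) * rate H (f t) u).
  rewrite mulNr -mulrN -(energyE _ _ m) mulr_sumr; apply: eq_bigr => u _; ring.
have -> : (fun h => (wnorm2 (f (t + h)) m - wnorm2 (f t) m) / h) =
    (fun h => \sum_u wdeg H u * ((f (t + h) u + f t u - 2 * m) *
       ((f (t + h) u - f t u) / h))).
  apply/funext => h; rewrite /wnorm2 -sumrB mulr_suml.
  by apply: eq_bigr => u _; ring.
apply: cvg_big => [|u _]; first exact: add_continuous.
apply: cvgMl_tmp; apply: cvgM (f_flow.2 t u t0).
by apply: cvgB (cvg_cst _); apply: cvgD (cvg_cst _).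
Unshelve. all: by end_near. Qed.

End Flow.

(** * Monotonicity of the Rayleigh quotient and decay of the variance *)

Section Decay.
Local Open Scope classical_set_scope.
Context {R : realType} {V : finType}.
Variables (H : hypergraph R V) (f : R -> {ffun V -> R}) (m : R).
Hypothesis f_flow : rate_flow H f.

Lemma Smax_neq0 (g : {ffun V -> R}) e : e \in edges H -> Smax g e != finset.set0.
Proof.
move=> eE; have [u ue [gu _]] := max_onP g (edges_neq0 eE).
by apply/set0Pn; exists u; rewrite inE ue gu /=.
Qed.

Lemma Imin_neq0 (g : {ffun V -> R}) e : e \in edges H -> Imin g e != finset.set0.
Proof.
move=> eE; have [u ue [gu _]] := min_onP g (edges_neq0 eE).
by apply/set0Pn; exists u; rewrite inE ue gu /=.
Qed.

(* Just after time [t] the maximum over [e] is attained in [Smax (f t) e] and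
   grows at the largest rate there; symmetrically for the minimum. *)
Lemma energy_dini t : 0 <= t ->
  dini_le (fun t => energy H (f t)) t
    (- 2 * \sum_u wdeg H u * rate H (f t) u ^+ 2).
Proof.
move=> t0 eps eps0.
set r := rate H (f t).
pose a e := max_on (Smax (f t) e) r; pose b e := min_on (Imin (f t) e) r.
have aP e : e \in edges H -> exists2 u, u \in Smax (f t) e &
    a e = r u /\ forall v, v \in Smax (f t) e -> r v <= r u.
  by move=> eE; apply: max_onP (Smax_neq0 _ eE).
have bP e : e \in edges H -> exists2 u, u \in Imin (f t) e &
    b e = r u /\ forall v, v \in Imin (f t) e -> r u <= r v.
  by move=> eE; apply: min_onP (Imin_neq0 _ eE).
have hG : \sum_u wdeg H u * r u ^+ 2 <=
    \sum_(e in edges H) cost H (f t) e * (b e - a e).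
  apply: sum_rate_sqr => e eE.
    by have [u ue [-> _]] := bP e eE; exists u.
  by have [u ue [-> _]] := aP e eE; exists u.
pose d e := max_on e (f t) - min_on e (f t).
pose C := \sum_(e in edges H) cost H (f t) e.
have C0 : 0 <= C by apply: sumr_ge0 => e; exact: cost_ge0.
(* Chosen so that [4 * del * C <= eps / 2]; the [+ 1] covers [C = 0]. *)
pose del := eps / (8 * (C + 1)).
have C1 : 0 < 8 * (C + 1) by lra.
have del0 : 0 < del by rewrite divr_gt0.
(* The coefficient of the second-order term in [h] when the squares are expanded below. *)
pose K := \sum_(e in edges H) weight H e * (a e - b e + 2 * del) ^+ 2.
(* Outside [Smax] a vertex has a positive gap below the maximum, which absorbs any rate for small
   [h]; inside, the gap is zero and [r u <= a e]. *)
have hmax : \forall h \near 0^'+, forall e, forall u, e \in edges H -> u \in e ->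
    h * (r u - a e) <= max_on e (f t) - f t u.
  apply: filter_forall => e; apply: filter_forall => u.
  have [eE|nE] := boolP (e \in edges H); last exact: nearW.
  have [ue|nu] := boolP (u \in e); last exact: nearW.
  have [uS|uS] := boolP (u \in Smax (f t) e).
    near=> h => _ _; have h0 : 0 < h by near: h; exact: nbhs_right_gt.
    have [v vS [av rv]] := aP e eE.
    have -> : max_on e (f t) - f t u = 0.
      by move: uS; rewrite inE => /andP[_ /eqP ->]; rewrite subrr.
    by rewrite pmulr_rle0 // subr_le0 av rv.
  near=> h => _ _; near: h; apply: near_right_mul_le; rewrite subr_gt0.
  have [v ve [fv vmax]] := max_onP (f t) (edges_neq0 eE).
  by rewrite lt_neqAle fv vmax // -fv andbT; move: uS; rewrite inE ue.
have hmin : \forall h \near 0^'+, forall e, forall u, e \in edges H -> u \in e ->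
    h * (b e - r u) <= f t u - min_on e (f t).
  apply: filter_forall => e; apply: filter_forall => u.
  have [eE|nE] := boolP (e \in edges H); last exact: nearW.
  have [ue|nu] := boolP (u \in e); last exact: nearW.
  have [uS|uS] := boolP (u \in Imin (f t) e).
    near=> h => _ _; have h0 : 0 < h by near: h; exact: nbhs_right_gt.
    have [v vS [bv rv]] := bP e eE.
    have -> : f t u - min_on e (f t) = 0.
      by move: uS; rewrite inE => /andP[_ /eqP ->]; rewrite subrr.
    by rewrite pmulr_rle0 // subr_le0 bv rv.
  near=> h => _ _; near: h; apply: near_right_mul_le; rewrite subr_gt0.
  have [v ve [fv vmin]] := min_onP (f t) (edges_neq0 eE).
  by rewrite lt_neqAle fv vmin // -fv andbT eq_sym; move: uS; rewrite inE ue.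
have hflow := flow_near f_flow t0 del0.
near=> h; have h0 : 0 < h by near: h; exact: nbhs_right_gt.
have hmax' : forall e u, e \in edges H -> u \in e ->
    h * (r u - a e) <= max_on e (f t) - f t u by near: h.
have hmin' : forall e u, e \in edges H -> u \in e ->
    h * (b e - r u) <= f t u - min_on e (f t) by near: h.
have hflow' : forall u, `|f (t + h) u - (f t u + h * r u)| <= h * del.
  by near: h.
have hK : h * K <= eps / 2 by near: h; apply: near_right_mul_le; lra.
have hd e : e \in edges H ->
    cost H (f (t + h)) e * (max_on e (f (t + h)) - min_on e (f (t + h))) <=
    weight H e * (d e + h * (a e - b e + 2 * del)) ^+ 2.
  move=> eE; have e0 := edges_neq0 eE.
  rewrite /cost -mulrA -expr2; apply: ler_wpM2l; first exact: weight_ge0.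
  have [u ue [-> _]] := max_onP (f (t + h)) e0.
  have [v ve [-> vmin]] := min_onP (f (t + h)) e0.
  have fvu : 0 <= f (t + h) u - f (t + h) v by rewrite subr_ge0 vmin.
  have le : f (t + h) u - f (t + h) v <= d e + h * (a e - b e + 2 * del).
    have := hflow' u; have := hflow' v; have := hmax' e u eE ue.
    have := hmin' e v eE ve; rewrite /d !ler_norml.
    by move=> ? ? /andP[? ?] /andP[? ?]; lra.
  by rewrite ler_sqr ?nnegrE // (le_trans fvu).
apply: (@le_trans _ _ (\sum_(e in edges H)
  weight H e * (d e + h * (a e - b e + 2 * del)) ^+ 2)).
  by apply: ler_sum => e; exact: hd.
have -> : \sum_(e in edges H)
      weight H e * (d e + h * (a e - b e + 2 * del)) ^+ 2 =
    energy H (f t)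
    - 2 * h * (\sum_(e in edges H) cost H (f t) e * (b e - a e))
    + 4 * h * del * C + h * (h * K).
  rewrite /energy /C /K !mulr_sumr -!sumrB -!big_split /=.
  by apply: eq_bigr => e _; rewrite /cost -/(d e); ring.
have hC : 4 * del * C <= eps / 2.
  rewrite /del; have -> : 4 * (eps / (8 * (C + 1))) * C = eps / 2 * (C / (C + 1)).
    by field; rewrite gt_eqF //; lra.
  by apply: ler_piMr; [lra | rewrite ler_pdivrMr; lra].
have := ler_wpM2l (ltW h0) hG; have := ler_wpM2l (ltW h0) hC.
have := ler_wpM2l (ltW h0) hK; lra.
Unshelve. all: by end_near. Qed.

Lemma wnorm2_near t eps : 0 <= t -> 0 < eps ->
  \forall h \near 0^'+,
    wnorm2 H (f t) m - h * (2 * energy H (f t) + eps) <= wnorm2 H (f (t + h)) m.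
Proof.
move=> t0 eps0; near=> h.
have h0 : 0 < h by near: h; exact: nbhs_right_gt.
have : - 2 * energy H (f t) - eps <=
    (wnorm2 H (f (t + h)) m - wnorm2 H (f t) m) / h.
  near: h; apply: (@cvgr_ge _ _ _ _ _ _ (wnorm2_right_derivative m f_flow t0)).
  by rewrite gtrBl.
by rewrite ler_pdivlMr //; lra.
Unshelve. all: by end_near. Qed.

(* The Rayleigh quotient cannot increase: if [energy > rho * wnorm2], then
   [0 <= sum_u w_u (r_u + rho (f_u - m))^2] forces [rho * energy] to lie below
   the dissipation [sum_u w_u r_u^2]. *)
Lemma energy_le_wnorm2 rho : 0 <= rho ->
  energy H (f 0) <= rho * wnorm2 H (f 0) m ->
  forall t, 0 <= t -> energy H (f t) <= rho * wnorm2 H (f t) m.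
Proof.
move=> rho0 E0 t t0; rewrite -subr_le0.
apply: (@dini_le0_nonpos _ (fun t => energy H (f t) - rho * wnorm2 H (f t) m));
  rewrite ?subr_le0 //; last first.
  move=> {t0}{}t t0; rewrite subr_gt0 => hpos eps eps0.
  set G := \sum_u wdeg H u * rate H (f t) u ^+ 2.
  have hG : rho * energy H (f t) <= G.
    have : 0 <= \sum_u wdeg H u * (rate H (f t) u + rho * (f t u - m)) ^+ 2.
      by apply: sumr_ge0 => u _; rewrite mulr_ge0 ?sqr_ge0 // ltW ?wdeg_gt0.
    have -> : \sum_u wdeg H u * (rate H (f t) u + rho * (f t u - m)) ^+ 2 =
        G - 2 * rho * energy H (f t) + rho ^+ 2 * wnorm2 H (f t) m.
      rewrite -[energy _ _]opprK -(energyE H (f t) m) /G /wnorm2 mulrN opprK.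
      rewrite !mulr_sumr -!big_split /=.
      by apply: eq_bigr => u _; ring.
    (* The square gives [G >= 2 * rho * E - rho ^+ 2 * N] for the energy [E] and the variance [N],
       and [hpos] gives [rho ^+ 2 * N <= rho * E]. *)
    by have := ler_wpM2l rho0 (ltW hpos); lra.
  have eps2 : 0 < eps / 2 by lra.
  pose eps' := eps / (2 * (rho + 1)).
  have eps'0 : 0 < eps' by rewrite divr_gt0 //; lra.
  have heps' : rho * eps' <= eps / 2.
    have -> : rho * eps' = eps / 2 * (rho / (rho + 1)).
      by rewrite /eps'; field; rewrite gt_eqF //; lra.
    by apply: ler_piMr; [lra | rewrite ler_pdivrMr; lra].
  near=> h; have h0 : 0 < h by near: h; exact: nbhs_right_gt.
  have hE : energy H (f (t + h)) <= energy H (f t) + h * (- 2 * G + eps / 2).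
    by near: h; exact: energy_dini.
  have : wnorm2 H (f t) m - h * (2 * energy H (f t) + eps') <=
      wnorm2 H (f (t + h)) m by near: h; exact: wnorm2_near.
  move/(ler_wpM2l rho0).
  have := ler_wpM2l (ltW h0) heps'; have := ler_wpM2l (ltW h0) hG.
  by lra.
move=> {t0}{}t t0; apply: cvgB (energy_continuous f_flow t0) _.
by apply: cvgMl_tmp; exact: wnorm2_continuous.
Unshelve. all: by end_near. Qed.

(** Integrating factor: the variance has right derivative [- 2 * energy], at least [- 2 * rho] times
    itself, so its product with [expR (2 * rho * t)] cannot fall below its initial value. *)
Lemma wnorm2_decay rho : 0 <= rho ->
  energy H (f 0) <= rho * wnorm2 H (f 0) m ->
  forall t, 0 <= t -> wnorm2 H (f 0) m <= expR (2 * rho * t) * wnorm2 H (f t) m.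
Proof.
move=> rho0 E0 t t0; rewrite -subr_le0.
apply: (@dini_le0_nonpos _
  (fun t => wnorm2 H (f 0) m - expR (2 * rho * t) * wnorm2 H (f t) m)) => //.
- move=> {t0}{}t t0; apply: cvgB; first exact: cvg_cst.
  apply: cvgM; last exact: wnorm2_continuous.
  apply: (@cvg_within_filter _ _ _ (nbhs t)).
  apply: continuous_comp; last exact: continuous_expR.
  exact: mulrl_continuous.
- by rewrite mulr0 expR0 mul1r subrr.
move=> {t0}{}t t0 _ eps eps0.
have N0 g : 0 <= wnorm2 H g m.
  by apply: sumr_ge0 => u _; rewrite mulr_ge0 ?sqr_ge0 // ltW ?wdeg_gt0.
set a := expR (2 * rho * t); have a0 : 0 < a by exact: expR_gt0.
set N := wnorm2 H (f t) m.
have hE : energy H (f t) <= rho * N by exact: energy_le_wnorm2.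
pose del := eps / (2 * a).
have adel : a * del = eps / 2 by rewrite /del; field; rewrite gt_eqF.
have del0 : 0 < del by rewrite divr_gt0 // mulr_gt0.
near=> h; have h0 : 0 < h by near: h; exact: nbhs_right_gt.
(* This is the second-order remainder; in first order the growth of the exponential cancels the loss
   of variance, up to [del]. *)
have hK : h * (a * (4 * rho ^+ 2 * N + 2 * rho * del)) <= eps / 2.
  by near: h; apply: near_right_mul_le; lra.
have hN : N - h * (2 * energy H (f t) + del) <= wnorm2 H (f (t + h)) m.
  by near: h; exact: wnorm2_near.
set X := wnorm2 H (f (t + h)) m in hN *.
have X1 : N - h * (2 * rho * N + del) <= X.
  by apply: le_trans hN; have := ler_wpM2l (ltW h0) hE; lra.
have b1 : 0 <= 1 + h * (2 * rho) by rewrite addr_ge0 // mulr_ge0 ?mulr_ge0 // ltW.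
(* Convexity, as [1 + x <= expR x], replaces differentiating the exponential. *)
have hexp : a * (1 + h * (2 * rho)) <= expR (2 * rho * (t + h)).
  rewrite [2 * rho * (t + h)]mulrDr expRD ler_pM2l // (le_trans _ (expR_ge1Dx _)) //.
  by rewrite [h * _]mulrC.
have := ler_wpM2r (N0 (f (t + h))) hexp; rewrite -/X.
have := ler_wpM2l (mulr_ge0 (ltW a0) b1) X1.
have := ler_wpM2l (ltW h0) hK.
have -> : a * (1 + h * (2 * rho)) * (N - h * (2 * rho * N + del)) =
  a * N - h * (a * del) - h * (h * (a * (4 * rho ^+ 2 * N + 2 * rho * del))).
  by ring.
by rewrite adel; lra.
Unshelve. all: by end_near. Qed.

End Decay.

(** * Scaling, truncation at a level, and weighted medians *)

Section InitialDistribution.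
Context {R : realType} {V : finType}.
Variable H : hypergraph R V.
Implicit Types (f g : {ffun V -> R}) (e U : {set V}) (c k : R).

Lemma costE f e :
  cost H f e * (max_on e f - min_on e f) =
  weight H e * (max_on e f - min_on e f) ^+ 2.
Proof. by rewrite /cost -mulrA -expr2. Qed.

Lemma energy_scale_le k g : 0 <= k ->
  energy H [ffun u => k * g u] <= k ^+ 2 * energy H g.
Proof.
move=> k0; rewrite mulr_sumr; apply: ler_sum => e eE.
rewrite !costE [k ^+ 2 * _]mulrCA -exprMn; apply: ler_wpM2l; first exact: weight_ge0.
have e0 := edges_neq0 eE.
have [u ue [-> umax]] := max_onP [ffun u => k * g u] e0.
have [v ve [-> _]] := min_onP [ffun u => k * g u] e0.
have [u' _ [-> gu']] := max_onP g e0; have [v' _ [-> gv']] := min_onP g e0.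
have := umax v ve; rewrite !ffunE => h.
have := ler_wpM2l k0 (gu' u ue); have := ler_wpM2l k0 (gv' v ve) => h1 h2.
by rewrite ler_sqr ?nnegrE //; lra.
Qed.

Definition above f c : {ffun V -> R} := [ffun u => Num.max (f u - c) 0].
Definition below f c : {ffun V -> R} := [ffun u => Num.max (c - f u) 0].

(** On each edge the spreads [a] and [b] of the two parts are nonnegative with sum at most the
    spread of [f], and [a ^+ 2 + b ^+ 2 <= (a + b) ^+ 2]. *)
Lemma energy_above_below f c :
  energy H (above f c) + energy H (below f c) <= energy H f.
Proof.
rewrite -big_split; apply: ler_sum => e eE /=.
rewrite !costE -mulrDr; apply: ler_wpM2l; first exact: weight_ge0.
have e0 := edges_neq0 eE.
have [u ue [-> umax]] := max_onP (above f c) e0.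
have [v ve [-> _]] := min_onP (above f c) e0.
have [u' ue' [-> umax']] := max_onP (below f c) e0.
have [v' ve' [-> _]] := min_onP (below f c) e0.
have [x xe [-> fx]] := max_onP f e0; have [z ze [-> fz]] := min_onP f e0.
have := umax v ve; have := umax' v' ve'.
have := fx u ue; have := fx v ve; have := fx u' ue'; have := fx v' ve'.
have := fz u ue; have := fz v ve; have := fz u' ue'; have := fz v' ve'.
rewrite !ffunE => h1 h2 h3 h4 h5 h6 h7 h8 h9 h10.
set a := Num.max (f u - c) 0 - Num.max (f v - c) 0.
set b := Num.max (c - f u') 0 - Num.max (c - f v') 0.
have a0 : 0 <= a by rewrite subr_ge0.
have b0 : 0 <= b by rewrite subr_ge0.
have ab : a + b <= f x - f z.
  rewrite /a /b.
  by case: (leP (f u - c) 0); case: (leP (f v - c) 0);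
     case: (leP (c - f u') 0); case: (leP (c - f v') 0) => *; lra.
have : (a + b) ^+ 2 <= (f x - f z) ^+ 2.
  by rewrite ler_sqr ?nnegrE //; lra.
have := mulr_ge0 a0 b0; lra.
Qed.

(** At every vertex at least one of the two parts vanishes, so the squares add. *)
Lemma wnorm2_above_below f c :
  wnorm2 H (above f c) 0 + wnorm2 H (below f c) 0 = wnorm2 H f c.
Proof.
rewrite /wnorm2 -big_split /=; apply: eq_bigr => u _; rewrite !ffunE !subr0.
have [h1|h1] := leP (f u - c) 0; have [h2|h2] := leP (c - f u) 0; try lra.
  have -> : f u = c by lra.
  by ring.
all: by ring.
Qed.

(** Take [c = f u] for the lowest [u] whose sublevel set carries at least half of the volume; the
    top vertex shows that such a [u] exists. *)
Lemma weighted_median f : (0 < #|V|)%N -> exists c : R,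
  2 * vol H [set u | c < f u] <= vol H [set: V] /\
  2 * vol H [set u | f u < c] <= vol H [set: V].
Proof.
case/card_gt0P => v0 _.
have V0 : 0 <= vol H [set: V] by apply: sumr_ge0 => x _; rewrite ltW ?wdeg_gt0.
have volC (A : {set V}) : vol H [set: V] = vol H A + vol H (~: A).
  rewrite -volU ?finset.setUCr //.
  by rewrite -finset.setI_eq0 finset.setICr.
pose P u := vol H [set: V] <= 2 * vol H [set v | f v <= f u].
case: (arg_maxP (fun u => f u) (erefl : xpredT v0)) => top _ topP.
have Ptop : P top.
  have E : [set v | f v <= f top] = [set: V].
    by apply/setP => v; rewrite !inE; exact: topP.
  by rewrite /P E; lra.
case: (arg_minP (fun u => f u) Ptop) => u Pu uP.
exists (f u); split.
  have := volC [set v | f v <= f u].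
  have -> : ~: [set v | f v <= f u] = [set v | f u < f v].
    by apply/setP => v; rewrite !inE ltNge.
  by move: Pu; rewrite /P; lra.
(* The strict sublevel set of [u] is empty or the sublevel set of the next lower value [f v], which
   has less than half of the volume by minimality of [u]. *)
have [->|/set0Pn[v1]] := eqVneq [set v | f v < f u] finset.set0.
  by rewrite /vol finset.big_set0 mulr0.
rewrite inE => v1u.
case: (@arg_maxP _ _ _ v1 (fun v => f v < f u) (fun u => f u) v1u) => v vu vP.
have -> : [set x | f x < f u] = [set x | f x <= f v].
  apply/setP => x; rewrite !inE; apply/idP/idP => [/vP//|xv].
  exact: le_lt_trans xv vu.
apply: ltW; rewrite ltNge; apply/negP => /uP.
by rewrite leNgt vu.
Qed.

End InitialDistribution.

(** * Construction of the initial density from [y] *)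

Section LowerBound.
Context {R : realType} {V : finType}.
Variables (H : hypergraph R V) (gamma : R).
Hypothesis gamma0 : 0 < gamma.

(** Unit mass on at most half of the volume [T] forces a squared norm of at least [2 / T], while
    recentring at the mean [1 / T] removes only [1 / T]. *)
Lemma half_supported_start (g : {ffun V -> R}) :
  (forall u, 0 <= g u) -> 0 < wnorm2 H g 0 ->
  energy H g <= gamma * wnorm2 H g 0 ->
  2 * vol H [set u | 0 < g u] <= vol H [set: V] ->
  exists f : {ffun V -> R},
    [/\ forall u, 0 <= f u, \sum_u wdeg H u * f u = 1,
      1 / 2 <= \sum_u wdeg H u * `|f u - (vol H [set: V])^-1|,
      (vol H [set: V])^-1 <= wnorm2 H f (vol H [set: V])^-1 &
      energy H f <= 2 * gamma * wnorm2 H f (vol H [set: V])^-1].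
Proof.
move=> g0 N0 Eg hS; set T := vol H [set: V] in hS *.
have [v gv] : exists v, 0 < g v.
  apply/existsP; apply: contraLR N0; rewrite negb_exists => /forallP h.
  rewrite -leNgt /wnorm2 big1 // => u _.
  have -> : g u = 0 by apply/eqP; rewrite eq_le g0 andbT leNgt h.
  by rewrite subrr expr0n mulr0.
have T0 : 0 < T by apply: vol_gt0; apply/set0Pn; exists v; rewrite inE.
pose A := \sum_u wdeg H u * g u.
have A0 : 0 < A.
  rewrite /A (bigD1 v) //= ltr_pwDl ?mulr_gt0 ?wdeg_gt0 //.
  by apply: sumr_ge0 => u _; rewrite mulr_ge0 // ltW ?wdeg_gt0.
pose f : {ffun V -> R} := [ffun u => A^-1 * g u].
have f0 u : 0 <= f u by rewrite ffunE mulr_ge0 // invr_ge0 ltW.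
have f1 : \sum_u wdeg H u * f u = 1.
  rewrite -(mulVf (lt0r_neq0 A0)) {2}/A mulr_sumr; apply: eq_bigr => u _.
  by rewrite ffunE mulrCA.
have TE : T = \sum_u wdeg H u by apply: eq_bigl => u; rewrite inE.
pose S := [set u | 0 < g u].
have fS u : u \notin S -> f u = 0.
  rewrite inE -leNgt ffunE => gu.
  by have -> : g u = 0; [apply/eqP; rewrite eq_le gu g0 | rewrite mulr0].
have vS : vol H S = \sum_u wdeg H u * (u \in S)%:R.
  by rewrite /vol big_mkcond; apply: eq_bigr => u _; case: ifP => _; rewrite ?mulr1 ?mulr0.
have Nf : wnorm2 H f 0 = A^-1 ^+ 2 * wnorm2 H g 0.
  by rewrite mulr_sumr; apply: eq_bigr => u _; rewrite ffunE !subr0; ring.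
(* [sum_(u in S) w_u (f_u - 2/T)^2 >= 0] with [sum_(u in S) w_u f_u = 1]
   and [2 * vol S <= T]. *)
have N2 : 2 / T <= wnorm2 H f 0.
  have : 0 <= \sum_u wdeg H u * (f u - 2 / T * (u \in S)%:R) ^+ 2.
    by apply: sumr_ge0 => u _; rewrite mulr_ge0 ?sqr_ge0 // ltW ?wdeg_gt0.
  have -> : \sum_u wdeg H u * (f u - 2 / T * (u \in S)%:R) ^+ 2 =
      wnorm2 H f 0 - 2 * (2 / T) * (\sum_u wdeg H u * f u)
      + (2 / T) ^+ 2 * vol H S.
    rewrite vS /wnorm2 !mulr_sumr -sumrB -big_split /=; apply: eq_bigr => u _.
    have [uS|/fS ->] := boolP (u \in S); rewrite /=; first by ring.
    by ring.
  rewrite f1 => h.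
  have : (2 / T) ^+ 2 * vol H S <= 2 / T.
    rewrite [leRHS](_ : _ = (2 / T) ^+ 2 * (T / 2)); last first.
      by field; rewrite gt_eqF.
    by rewrite ler_wpM2l ?sqr_ge0 //; rewrite /S; lra.
  by lra.
have Nm : wnorm2 H f T^-1 = wnorm2 H f 0 - T^-1.
  have -> : wnorm2 H f T^-1 =
      wnorm2 H f 0 - 2 * T^-1 * (\sum_u wdeg H u * f u) + T^-1 ^+ 2 * T.
    rewrite {4}TE /wnorm2 !mulr_sumr -sumrB -big_split /=.
    by apply: eq_bigr => u _; ring.
  by rewrite f1; field; rewrite gt_eqF.
exists f; split => //.
(* Outside [S] each vertex contributes [wdeg H u / T], and that complement has at least half of the
   volume. *)
- apply: (@le_trans _ _ (\sum_u wdeg H u * (T^-1 * (1 - (u \in S)%:R)))); last first.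
    apply: ler_sum => u _; rewrite ler_wpM2l ?(ltW (wdeg_gt0 H u)) //.
    have [uS|/fS->] := boolP (u \in S); first by rewrite subrr mulr0.
    by rewrite subr0 mulr1 sub0r normrN ler_norm.
  have -> : \sum_u wdeg H u * (T^-1 * (1 - (u \in S)%:R)) = T^-1 * (T - vol H S).
    have -> : T - vol H S = \sum_u wdeg H u * (1 - (u \in S)%:R).
      by rewrite TE vS -sumrB; apply: eq_bigr => u _; ring.
    by rewrite mulr_sumr; apply: eq_bigr => u _; ring.
  by rewrite [T^-1 * _]mulrC ler_pdivlMr // /S; lra.
- by rewrite Nm; lra.
have : energy H f <= gamma * wnorm2 H f 0.
  apply: le_trans (energy_scale_le H g _) _; first by rewrite invr_ge0 ltW.
  by rewrite Nf mulrCA ler_wpM2l ?sqr_ge0.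
(* The factor [2] arises here: [N2] makes the removed [1 / T] at most half of the squared norm. *)
move/le_trans; apply; rewrite Nm [2 * _]mulrC -mulrA ler_pM2l //; lra.
Qed.

(** Orthogonality to [x1] gives [f] weighted mean zero, so moving the centre to a median can only
    increase the variance. The energies of the two parts then sum to at most [gamma] times the sum
    of their norms, so one part inherits the bound. *)
Lemma rayleigh_start (y : {ffun V -> R}) :
  y != 0 -> dot y (x1 H) = 0 -> rayleigh H y <= gamma ->
  exists g : {ffun V -> R},
    [/\ forall u, 0 <= g u, 0 < wnorm2 H g 0,
      energy H g <= gamma * wnorm2 H g 0 &
      2 * vol H [set u | 0 < g u] <= vol H [set: V]].
Proof.
move=> y0 yx1 Ry; pose f : {ffun V -> R} := [ffun v => y v / Num.sqrt (wdeg H v)].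
have s0 u : 0 < Num.sqrt (wdeg H u) by rewrite sqrtr_gt0 wdeg_gt0.
have s2 u : Num.sqrt (wdeg H u) ^+ 2 = wdeg H u by rewrite sqr_sqrtr // ltW ?wdeg_gt0.
have yE u : y u = Num.sqrt (wdeg H u) * f u.
  by rewrite ffunE mulrC divfK // gt_eqF.
have fdot : \sum_u wdeg H u * f u = 0.
  rewrite -[RHS]yx1 /dot; apply: eq_bigr => u _.
  by rewrite yE [x1 H u]ffunE -{1}s2; ring.
have ydot : dot y y = wnorm2 H f 0.
  rewrite /dot /wnorm2.
  by apply: eq_bigr => u _; rewrite !yE subr0 -{3}s2; ring.
have yL : dot y (normalized_laplacian H y) = energy H f.
  rewrite -[RHS]opprK -(energyE H f 0) -sumrN /dot; apply: eq_bigr => u _.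
  rewrite yE [normalized_laplacian H y u]ffunE [weighted_laplacian H _ u]ffunE.
  by rewrite -/f subr0 -[in RHS]s2; ring.
have Nge0 (g : {ffun V -> R}) c : 0 <= wnorm2 H g c.
  by apply: sumr_ge0 => u _; rewrite mulr_ge0 ?sqr_ge0 // ltW ?wdeg_gt0.
have [u0 yu0] : exists u, y u != 0.
  apply/existsP; apply: contraNT y0; rewrite negb_exists => /forallP h.
  by apply/eqP/ffunP => u; rewrite [RHS]ffunE; apply/eqP; have := h u; rewrite negbK.
have N0 : 0 < wnorm2 H f 0.
  rewrite -ydot /dot (bigD1 u0) //= ltr_pwDl //.
    by rewrite -expr2 lt_neqAle eq_sym sqrf_eq0 yu0 sqr_ge0.
  by apply: sumr_ge0 => u _; rewrite -expr2 sqr_ge0.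
have Ef : energy H f <= gamma * wnorm2 H f 0.
  by move: Ry; rewrite /rayleigh yL ydot ler_pdivrMr.
have [|c [ca cb]] := weighted_median H f.
  by apply/card_gt0P; exists u0.
have Nc : wnorm2 H f 0 <= wnorm2 H f c.
  have -> : wnorm2 H f c = wnorm2 H f 0 - 2 * c * (\sum_u wdeg H u * f u)
      + c ^+ 2 * (\sum_u wdeg H u).
    rewrite /wnorm2 !mulr_sumr -sumrB -big_split /=.
    by apply: eq_bigr => u _; ring.
  rewrite fdot mulr0 subr0 lerDl mulr_ge0 ?sqr_ge0 //.
  by apply: sumr_ge0 => u _; rewrite ltW ?wdeg_gt0.
have hE := energy_above_below H f c; have hN := wnorm2_above_below H f c.
have E0 g : 0 <= energy H g.
  apply: sumr_ge0 => e eE; rewrite costE mulr_ge0 ?sqr_ge0 //.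
  exact: weight_ge0.
have ha u : (0 < above f c u) = (c < f u).
  by rewrite ffunE lt_max ltxx orbF subr_gt0.
have hb u : (0 < below f c u) = (f u < c).
  by rewrite ffunE lt_max ltxx orbF subr_gt0.
have hsum : energy H (above f c) + energy H (below f c) <=
    gamma * wnorm2 H (above f c) 0 + gamma * wnorm2 H (below f c) 0.
  rewrite -mulrDr hN (le_trans hE) // (le_trans Ef) // ler_pM2l //.
have [good|bad] := boolP ((0 < wnorm2 H (above f c) 0) &&
    (energy H (above f c) <= gamma * wnorm2 H (above f c) 0)).
  have [? ?] := andP good; exists (above f c); split => //.
    by move=> u; rewrite ffunE le_max lexx orbT.
  by under [X in vol H X]eq_finset do rewrite ha.
have [Nb Eb] : 0 < wnorm2 H (below f c) 0 /\
    energy H (below f c) <= gamma * wnorm2 H (below f c) 0.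
  (* If the upper part is zero, the lower one carries the whole norm; if it violates the bound,
     [hsum] makes the lower one satisfy it strictly, hence with positive norm. *)
  have := Nge0 (above f c) 0; rewrite le_eqVlt => /orP[/eqP Na0|Na].
    move: hsum; rewrite -Na0; have := E0 (above f c).
    by split; lra.
  move: bad; rewrite Na /= -ltNge => Ea.
  have lt : energy H (below f c) < gamma * wnorm2 H (below f c) 0 by lra.
  split; last exact: ltW.
  by rewrite -(pmulr_rgt0 _ gamma0) (le_lt_trans (E0 _) lt).
exists (below f c); split => //.
  by move=> u; rewrite ffunE le_max lexx orbT.
by under [X in vol H X]eq_finset do rewrite hb.
Qed.

End LowerBound.

(** * From the decay of the variance to the lower bound on the [L1] distance *)

Theorem mainTheorem4 (R : realType) (V : finType) (H : hypergraph R V)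
    (gamma : R) (hV : (2 <= #|V|)%N) (hgamma : 0 < gamma)
    (hy : exists y : {ffun V -> R},
        [/\ y != 0, dot y (x1 H) = 0 & rayleigh H y <= gamma]) :
  exists phi0 : {ffun V -> R},
    [/\ is_distribution phi0,
        1 / 2 <= norm1 (phi0 - stationary H) &
        forall (delta t : R) (phi : R -> {ffun V -> R}),
          0 < delta ->
          0 <= t ->
          t <= 1 / (4 * gamma) *
               ln (Num.sqrt (min_on [set: V] (stationary H)) / (2 * delta)) ->
          is_diffusion H phi0 phi ->
          delta <= norm1 (phi t - stationary H)].
Proof.
case: hy => y [y0 yx1 Ry].
have [g [g0 Ng Eg hS]] := rayleigh_start hgamma y0 yx1 Ry.
have [f0 [f0_ge0 f0_sum f0_far f0_norm f0_energy]] :=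
  half_supported_start hgamma g0 Ng Eg hS.
set T := vol H [set: V] in f0_far f0_norm f0_energy.
have [v0 _] : exists v, v \in V by apply/card_gt0P; exact: leq_trans hV.
have V0 : [set: V] != finset.set0 by apply/set0Pn; exists v0; rewrite inE.
have T0 : 0 < T by exact: vol_gt0.
have dist (phi : {ffun V -> R}) : norm1 (phi - stationary H) =
    \sum_u wdeg H u * `|phi u / wdeg H u - T^-1|.
  apply: eq_bigr => u _; have w0 := wdeg_gt0 H u.
  rewrite !ffunE -{2}(gtr0_norm w0) -normrM mulrBr mulrCA divff ?gt_eqF //.
  by rewrite mulr1.
pose phi0 : {ffun V -> R} := [ffun u => wdeg H u * f0 u].
have phi0E u : phi0 u / wdeg H u = f0 u.
  by rewrite ffunE mulrAC divff ?mul1r // gt_eqF ?wdeg_gt0.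
exists phi0; split.
- split=> [u|]; first by rewrite ffunE mulr_ge0 // ltW ?wdeg_gt0.
  by rewrite -f0_sum; apply: eq_bigr => u _; rewrite ffunE.
- by rewrite dist; under eq_bigr do rewrite phi0E.
move=> delta t phi delta0 t0 ht hphi.
pose f t : {ffun V -> R} := [ffun v => phi t v / wdeg H v].
have f_flow : rate_flow H f by exact: is_diffusion_flow hphi.
have f_0 : f 0 = f0.
  by case: hphi => phi_0 _ _; apply/ffunP => u; rewrite ffunE phi_0 phi0E.
have rho0 : 0 <= 2 * gamma by lra.
have := @wnorm2_decay _ _ H f T^-1 f_flow (2 * gamma) rho0.
rewrite f_0 => /(_ f0_energy t t0).
set a := expR _ => decay.
have [v1 _ [qE qmin]] := min_onP (stationary H) V0.
set q := min_on _ _ in ht qE.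
have q0 : 0 < q by rewrite qE ffunE divr_gt0 ?wdeg_gt0.
have qw u : q * T <= wdeg H u.
  by have := qmin u (finset.in_setT u); rewrite -qE ffunE ler_pdivlMr.
have a1 : 1 <= a.
  by rewrite -expR0 ler_expR !mulr_ge0 // ltW.
(* The time bound in exponential form: with [rho = 2 * gamma], [a] is the exponential of
   [4 * gamma * t]. *)
have ha : a * (2 * delta) <= Num.sqrt q.
  rewrite -ler_pdivlMr ?mulr_gt0 //.
  have x0 : 0 < Num.sqrt q / (2 * delta).
    by rewrite divr_gt0 ?sqrtr_gt0 ?mulr_gt0.
  rewrite -(@lnK _ (Num.sqrt q / (2 * delta))) ?posrE // ler_expR.
  move: ht; rewrite mulrC mulrA mulr1 ler_pdivlMr ?mulr_gt0 //.
  by lra.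
set X := norm1 _.
have X0 : 0 <= X by apply: sumr_ge0.
(* The sum of the squared terms of [X] is at most [X ^+ 2], and in each of them one factor
   [wdeg H u] is at least [q * T]. *)
have XN : q * T * wnorm2 H (f t) T^-1 <= X ^+ 2.
  have XE : X = \sum_u wdeg H u * `|f t u - T^-1|.
    by rewrite /X dist; apply: eq_bigr => u _; rewrite ffunE.
  rewrite /wnorm2 mulr_sumr expr2 {1}XE mulr_suml; apply: ler_sum => u _.
  have w0 := wdeg_gt0 H u.
  apply: (@le_trans _ _ ((wdeg H u * `|f t u - T^-1|) * (wdeg H u * `|f t u - T^-1|))).
    rewrite -(real_normK (num_real (f t u - T^-1))).
    have -> : wdeg H u * `|f t u - T^-1| * (wdeg H u * `|f t u - T^-1|) =
      wdeg H u * (wdeg H u * `|f t u - T^-1| ^+ 2) by ring.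
    apply: ler_wpM2r (qw u); first by rewrite mulr_ge0 ?sqr_ge0 ?ltW.
  apply: ler_wpM2l; first by rewrite mulr_ge0 // ltW.
  rewrite XE (bigD1 u) //= lerDl; apply: sumr_ge0 => v _.
  by rewrite mulr_ge0 // ltW ?wdeg_gt0.
(* Chains [1 / T <= N(0) <= a * N(t)], for the variance [N], with [XN], after scaling by [q * T]. *)
have qX : q <= a * X ^+ 2.
  have a0 : 0 <= a by lra.
  have := ler_wpM2l a0 XN.
  have qT0 : 0 <= q * T by rewrite mulr_ge0 ?ltW.
  have := ler_wpM2l qT0 (le_trans f0_norm decay).
  by rewrite mulfK ?gt_eqF // mulrCA => h1 h2; exact: le_trans h1 h2.
have : (a * (2 * delta)) ^+ 2 <= q.
  rewrite -(sqr_sqrtr (ltW q0)) ler_sqr ?nnegrE ?sqrtr_ge0 //.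
  by rewrite !mulr_ge0 //; lra.
(* One factor [a] cancels between the two bounds on [q]; the other is at least [1]. *)
move=> h; have {h qX} : a * (a * (4 * delta ^+ 2)) <= a * X ^+ 2.
  by apply: le_trans qX; apply: le_trans h; rewrite le_eqVlt; apply/orP; left; apply/eqP; ring.
rewrite ler_pM2l; last by lra.
move=> h; have d2 : 0 < delta ^+ 2 by rewrite exprn_gt0.
have : delta ^+ 2 <= X ^+ 2.
  have : 1 * (4 * delta ^+ 2) <= a * (4 * delta ^+ 2) by rewrite ler_wpM2r //; lra.
  by lra.
by rewrite ler_sqr ?nnegrE // ltW.
Qed.
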